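(* Let $V$ be an almost surely positive random variable on $(\Omega,\mathcal F,P)$ with $EV^2<\infty$, and let $\rho,\mu\in(0,\infty)$ be constants, as in the context. For $v>0$ and $\lambda\in\mathbb R$ put $$x(v,\lambda)=\frac{v\left(\lambda-\frac v2\right)^+}{2\mu\rho},\qquad \xi(\lambda)=Ex(V,\lambda).$$ For $\alpha\geq 0$ consider the problem of minimizing $$E\left[\frac{VX}{2}+\mu\rho\frac{X^2}{V}\right]$$ over all random variables $X$ on $(\Omega,\mathcal F,P)$ with $X\ge 0$ $P$-a.s. and $EX=\alpha$. Then: (i) $\xi$ is continuous on $[0,\infty)$; (ii) for every $\alpha>0$ there exists $\lambda_\alpha>0$ such that $\xi(\lambda_\alpha)=\alpha$, and $X=x(V,\lambda_\alpha)$ is a solution (minimizer) of the problem of minimizing $E\left[\frac{VX}{2}+\mu\rho\frac{X^2}{V}\right]$ over all random variables $X$ on $(\Omega,\mathcal F,P)$ with $X\ge 0$ $P$-a.s. and $EX=\alpha$; (iii) for every $\alpha>0$ the optimal value of the problem of minimizing $E\left[\frac{VX}{2}+\mu\rho\frac{X^2}{V}\right]$ over all random variables $X$ on $(\Omega,\mathcal F,P)$ with $X\ge 0$ $P$-a.s. and $EX=\alpha$ is $$f(\alpha)=\frac{1}{4\mu\rho}E\left\{V\left[\lambda_\alpha^2-\left(\frac V2\right)^2\right]^+\right\},$$ and, with $f(0)=0$ (the optimal value for $\alpha=0$), the function $f$ is finite, convex, nondecreasing and continuous on $[0,\infty)$.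
   Context: Notation: $a^+=\max\{a,0\}$. In the paper, $V=J_\tau$, where $J$ is a subordinator with mean rate $\rho=EJ_1\in(0,\infty)$ and Lévy measure $\nu$, $\tau$ is a stopping time with $E\tau<\infty$ and $J_\tau>0$ a.s., $EV^2<\infty$, and $\mu=\frac{1}{2\rho}\int_{(0,\infty)}x^2\nu(dx)$, assumed to be in $(0,\infty)$. Only $V>0$ a.s., $EV^2<\infty$ and $\rho,\mu\in(0,\infty)$ enter the statement. *)

(* Defs.v *)
From HB Require Import structures.
From mathcomp Require Import all_boot all_order all_algebra.
From mathcomp Require Import all_classical all_reals all_analysis.
Set Implicit Arguments.
Unset Strict Implicit.
Unset Printing Implicit Defensive.
Import Order.TTheory GRing.Theory Num.Theory.
Import numFieldNormedType.Exports.
Local Open Scope classical_set_scope.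
Local Open Scope ring_scope.

Section problem.
Context d (T : measurableType d) (R : realType) (P : probability T R).
Variables (V : T -> R) (mu rho : R).

Definition xopt (v lambda : R) : R :=
  v * Num.max (lambda - v / 2) 0 / (2 * mu * rho).

(* Expectations live in \bar R, so that they make sense before any
   integrability has been established. *)
Definition xi (lambda : R) : \bar R := 'E_P[fun w => xopt (V w) lambda]%E.

(* X w ^+ 2 / V w takes MathComp's value 0 when V w = 0; this is immaterial as
   V > 0 almost surely. The value may be +oo. *)
Definition objective (X : T -> R) : \bar R :=
  'E_P[fun w => (V w * X w / 2 + mu * rho * (X w ^+ 2 / V w))%R]%E.

Definition feasible (alpha : R) : set (T -> R) :=
  [set X : T -> R | [/\ measurable_fun setT X, {ae P, forall w, 0 <= X w}
             & 'E_P[X]%E = alpha%:E]].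

Definition is_minimizer (alpha : R) (X : T -> R) : Prop :=
  feasible alpha X /\
  forall Y, feasible alpha Y -> (objective X <= objective Y)%E.

Definition optimal_value (alpha : R) : \bar R :=
  ereal_inf (objective @` feasible alpha).

(* lam selects the multiplier lambda_alpha attached to each alpha > 0. *)
Definition value_fun (lam : R -> R) (alpha : R) : \bar R :=
  if alpha == 0 then 0%:E
  else ((1 / (4 * mu * rho))%:E *
        'E_P[fun w => (V w * Num.max (lam alpha ^+ 2 - (V w / 2) ^+ 2) 0)%R])%E.

End problem.

(* Main.v *)
(* Lagrangian duality. For v > 0 and x >= 0 write c(v, x) for the cost
   v x / 2 + mu rho x ^ 2 / v. Then x(v, lambda) minimizes the strictly convex
   map x |-> c(v, x) - lambda x on [0, +oo[, and integrating this pointwise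
   optimality gives, for every feasible Y of mean beta,
     E c(V, x(V, lambda)) + lambda (beta - xi(lambda)) <= E c(V, Y).
   With beta = xi(lambda) this is optimality; as beta varies it says that
   lambda_alpha is a slope of a supporting line of f at alpha > 0, which yields
   convexity, monotonicity and local Lipschitz continuity of f down to 0. The
   multiplier comes from the intermediate value theorem: xi is Lipschitz with
   constant E V / (2 mu rho), vanishes at 0 and is bounded below by an affine
   function of slope E V / (2 mu rho) > 0. *)
Require Import Defs.
From HB Require Import structures.
From mathcomp Require Import all_boot all_order all_algebra.
From mathcomp Require Import all_classical all_reals all_analysis.
From mathcomp Require Import measurable_realfun ring lra.
Set Implicit Arguments.
Unset Strict Implicit.
Unset Printing Implicit Defensive.
Import Order.TTheory GRing.Theory Num.Theory.
Import numFieldNormedType.Exports.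
Local Open Scope classical_set_scope.
Local Open Scope ring_scope.

(** * Measurability and almost sure comparison of expectations *)

Lemma measurable_invr (R : realType) :
  measurable_fun [set: R] (@GRing.inv R).
Proof.
(* The default [0^-1 = 0] makes inversion a case split, so that continuity has to be used only on
   the open set of nonzero points. *)
rewrite (_ : @GRing.inv R = fun x => if x == 0 then 0 else x^-1); last first.
  by apply/funext => x; case: eqVneq => // ->; rewrite invr0.
apply: measurable_fun_if => //; first exact: measurable_fun_eqr.
rewrite setTI (_ : _ @^-1` _ = [set x : R | x != 0]); last first.
  by apply/seteqP; split => x /=; case: eqVneq.
apply: open_continuous_measurable_fun; first exact: open_neq.
by move=> x; rewrite inE /= => x0; exact: inv_continuous.
Qed.

Section expectation_ae.
Context d (T : measurableType d) (R : realType) (P : probability T R).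
Implicit Types (X Y : T -> R) (a b : R).

(** Infinite expectations are covered: positive parts compare in one direction, negative parts in
    the other, and subtraction in [\bar R] is monotone even at infinite values. *)
Lemma ae_expectation_le X Y : measurable_fun setT X -> measurable_fun setT Y ->
  {ae P, forall w, X w <= Y w} -> ('E_P[X] <= 'E_P[Y])%E.
Proof.
move=> mX mY XY; rewrite unlock integralE [leRHS]integralE.
have [mX' mY'] : measurable_fun setT (EFin \o X) /\
    measurable_fun setT (EFin \o Y).
  by split; exact/measurable_EFinP.
apply: leeB; apply: ae_ge0_le_integral => //.
- exact: measurable_funepos.
- exact: measurable_funepos.
- apply: filterS XY => w XYw _.
  by rewrite !funeposE /= ge_max !le_max lee_fin XYw lexx orbT.
- exact: measurable_funeneg.
- exact: measurable_funeneg.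
- apply: filterS XY => w XYw _.
  by rewrite !funenegE /= ge_max !le_max !lee_fin lerN2 XYw lexx orbT.
Qed.

Lemma ae_expectation_eq X Y : measurable_fun setT X -> measurable_fun setT Y ->
  {ae P, forall w, X w = Y w} -> 'E_P[X]%E = 'E_P[Y]%E.
Proof.
move=> mX mY XY; apply/eqP; rewrite eq_le; apply/andP.
by split; apply: ae_expectation_le => //; apply: filterS XY => w ->.
Qed.

Lemma Lfun1_ae_dominated X Y : measurable_fun setT X -> Y \in Lfun P 1 ->
  {ae P, forall w, `|X w| <= Y w} -> X \in Lfun P 1.
Proof.
move=> mX LY XY; have /Lfun1_integrable/integrableP[mY iY] := Lfun_norm LY.
apply/Lfun1_integrable/integrableP; split; first exact/measurable_EFinP.
apply: le_lt_trans iY; apply: ae_ge0_le_integral => //.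
- by apply: measurableT_comp => //; exact/measurable_EFinP.
- exact: measurableT_comp.
- apply: filterS XY => w XYw _ /=.
  by rewrite lee_fin normr_id (le_trans XYw)// ler_norm.
Qed.

Lemma Lfun1_linear X Y a b : X \in Lfun P 1 -> Y \in Lfun P 1 ->
  (fun w => a * X w + b * Y w) \in Lfun P 1.
Proof.
move=> LX LY; rewrite (_ : (fun _ => _) = (a \o* X) + (b \o* Y)); last first.
  by apply/funext => w; rewrite fctE /= ![_ * a]mulrC ![_ * b]mulrC.
by apply: rpredD; exact: Lfun_scale.
Qed.

Lemma expectation_linear X Y a b : X \in Lfun P 1 -> Y \in Lfun P 1 ->
  ('E_P[fun w => (a * X w + b * Y w)%R] = a%:E * 'E_P[X] + b%:E * 'E_P[Y])%E.
Proof.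
move=> LX LY; rewrite -!expectationZl// -expectationD; try exact: Lfun_scale.
by congr ('E_P[_])%E; apply/funext => w /=; rewrite ![_ * a]mulrC ![_ * b]mulrC.
Qed.

Lemma expectation_ae_ge0 X : measurable_fun setT X ->
  {ae P, forall w, 0 <= X w} -> (0 <= 'E_P[X])%E.
Proof.
by move=> mX X0; rewrite -[0%E](expectation_cst P) ae_expectation_le.
Qed.

Lemma ae_ge0_Lfun1 X : measurable_fun setT X -> {ae P, forall w, 0 <= X w} ->
  ('E_P[X] < +oo)%E -> X \in Lfun P 1.
Proof.
move=> mX X0 Xoo; apply/Lfun1_integrable/integrableP.
split; first exact/measurable_EFinP.
apply: le_lt_trans Xoo; rewrite unlock.
have -> : (\int[P]_x `|(EFin \o X) x|)%E = 'E_P[fun w => `|X w|%R]%E.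
  by rewrite unlock.
have -> : (\int[P]_x (X x)%:E)%E = 'E_P[X]%E by rewrite unlock.
apply: ae_expectation_le => //; first exact: measurableT_comp.
by apply: filterS X0 => w /ger0_norm ->.
Qed.

Lemma ae_ge0_expectation_eq0 X : measurable_fun setT X ->
  {ae P, forall w, 0 <= X w} -> 'E_P[X]%E = 0%E -> {ae P, forall w, X w = 0}.
Proof.
move=> mX X0 EX.
have mEX : measurable_fun setT (EFin \o X) by exact/measurable_EFinP.
have [+ _] := ae_eq_integral_abs P measurableT mEX.
have -> : (\int[P]_x `|(EFin \o X) x|)%E = 'E_P[fun w => `|X w|%R]%E.
  by rewrite unlock.
rewrite (@ae_expectation_eq _ X)//; first last.
- by apply: filterS X0 => w /ger0_norm ->.
- exact: measurableT_comp.
by move=> /(_ EX); apply: filterS => w /(_ I) [].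
Qed.

End expectation_ae.

(** * Continuity and supporting lines on the half-line *)

Lemma locally_lipschitz_within_itvcy (R : realType) (f K : R -> R) :
  (forall M a b, 0 <= a -> a <= b -> b <= M -> 0 < M ->
    `|f b - f a| <= K M * (b - a)) ->
  {within `[0, +oo[, continuous f}.
Proof.
move=> fK; apply/subspace_continuousP => x; rewrite /= in_itv /= andbT => x0.
(* Points within distance 1 of [x] lie below [x + 1], so the constant at [x + 1] serves them all.
   The absolute value and the added 1 make it positive, hence [e / k] a legitimate radius. *)
pose k := `|K (x + 1)| + 1.
have k0 : 0 < k by rewrite ltr_wpDl.
have Kk : K (x + 1) <= k by rewrite /k ler_wpDr// ler_norm.
have fk a b : 0 <= a -> a <= b -> b <= x + 1 -> `|f b - f a| <= k * (b - a).
  move=> a0 ab bx; apply: le_trans (fK (x + 1) a b a0 ab bx _) _; first lra.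
  by rewrite ler_wpM2r// subr_ge0.
apply/cvgrPdist_le => e e0; rewrite near_withinE; near=> y.
rewrite /= in_itv /= andbT => y0.
have yx1 : `|x - y| <= 1 by near: y; exact: (cvgr_dist_le _ _ _ _).
have yxe : `|x - y| <= e / k.
  by near: y; apply: (cvgr_dist_le _ _ _ _); rewrite ?divr_gt0.
suff : `|f x - f y| <= k * `|x - y|.
  by move/le_trans; apply; rewrite mulrC -ler_pdivlMr.
move: yx1; have [xy|yx] := leP x y.
  rewrite !(distrC x) (distrC (f x)) ger0_norm ?subr_ge0// => ?.
  by apply: fk => //; lra.
rewrite ger0_norm ?subr_ge0 ?(ltW yx)// => ?.
by apply: fk => //; lra.
Unshelve. all: by end_near.
Qed.

Section supporting_lines.
Context (R : realType) (f l : R -> R).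
Hypotheses (l_gt0 : forall a, 0 < a -> 0 < l a)
  (f_support : forall a b, 0 < a -> 0 <= b -> f a + l a * (b - a) <= f b)
  (f0 : f 0 = 0) (f_ge0 : forall b, 0 <= b -> 0 <= f b).

Lemma supporting_lines_nondecreasing a b : 0 <= a -> a <= b -> f a <= f b.
Proof.
rewrite le_eqVlt => /predU1P[<- b0|a0 ab]; first by rewrite f0 f_ge0.
apply: le_trans (f_support a0 (le_trans (ltW a0) ab)).
by rewrite lerDl mulr_ge0 ?subr_ge0// ltW// l_gt0.
Qed.

(** The supporting line at the intermediate point [z] lies below [f] at [x] and [y], and its values
    there average exactly to [f z]. At [z = 0], where no line is given, [f0] and [f_ge0] suffice. *)
Lemma supporting_lines_convex :
  convex_function (`[0, +oo[%classic : set R) f.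
Proof.
move=> t x y; rewrite !inE /= !in_itv /= !andbT => x0 y0.
have t0 : 0 <= t%:num by exact: ge0.
have t1 : 0 <= (1 - t%:num) by rewrite subr_ge0 le1.
change (f (t%:num * x + (1 - t%:num) * y) <= t%:num * f x + (1 - t%:num) * f y).
set z := _ + _ * y; have : 0 <= z by rewrite addr_ge0// mulr_ge0.
rewrite le_eqVlt => /predU1P[<-|z0].
  by rewrite f0 addr_ge0// mulr_ge0// f_ge0.
have -> : f z = t%:num * (f z + l z * (x - z)) + (1 - t%:num) * (f z + l z * (y - z)).
  by rewrite /z; ring.
by apply: lerD; apply: ler_wpM2l => //; exact: f_support.
Qed.

Lemma supporting_lines_continuous : {within `[0, +oo[, continuous f}.
Proof.
apply: (@locally_lipschitz_within_itvcy _ _ l) => M a b a0 ab bM M0.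
rewrite ger0_norm ?subr_ge0 ?supporting_lines_nondecreasing//.
have [->|nab] := eqVneq a b; first by rewrite !subrr mulr0.
have {}ab : a < b by rewrite lt_neqAle nab.
have b0 : 0 < b := le_lt_trans a0 ab.
(* The slopes are nondecreasing, so [l M] is a Lipschitz constant on [0, M],
   including at 0, where no slope is given. *)
have lbM : b < M -> l b <= l M.
  move=> bltM; rewrite -(ler_pM2r (_ : 0 < M - b)) ?subr_gt0//.
  (* The line at [b] tested at [M] and the line at [M] tested at [b] add up to
     [(l b - l M) * (M - b) <= 0]. *)
  have := f_support b0 (ltW M0); have := f_support M0 (ltW b0).
  by move=> ? ?; lra.
have {}lbM : l b <= l M.
  by move: bM; rewrite le_eqVlt => /predU1P[->|/lbM].
have := f_support b0 a0.
have : l b * (b - a) <= l M * (b - a) by rewrite ler_wpM2r// subr_ge0 ltW.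
move=> ? ?; lra.
Qed.

End supporting_lines.

(** * Pointwise bounds and optimality for a fixed value [v] of [V] *)

Section pointwise.
Context (R : realType) (mu rho : R).
Hypotheses (mu_gt0 : 0 < mu) (rho_gt0 : 0 < rho).
Implicit Types v a b x y lambda : R.

Local Notation k := (2 * mu * rho).
Local Notation xopt := (xopt mu rho).
Let cost v x := v * x / 2 + mu * rho * (x ^+ 2 / v).

Let k_gt0 : 0 < k. Proof. by rewrite !mulr_gt0. Qed.

Lemma xopt_ge0 v lambda : 0 <= v -> 0 <= xopt v lambda.
Proof.
by move=> v0; rewrite /xopt divr_ge0 ?(ltW k_gt0)// mulr_ge0// le_max lexx orbT.
Qed.

Lemma xopt_le v lambda : 0 <= v -> xopt v lambda <= `|lambda| / k * v.
Proof.
move=> v0; rewrite /xopt [leRHS]mulrC mulrA ler_pM2r ?invr_gt0// ler_wpM2l//.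
rewrite ge_max normr_ge0 andbT (le_trans _ (ler_norm _))//.
by rewrite lerBlDr lerDl divr_ge0.
Qed.

Lemma xopt_nondecreasing v a b : 0 <= v -> a <= b -> xopt v a <= xopt v b.
Proof.
move=> v0 ab; rewrite /xopt ler_pM2r ?invr_gt0// ler_wpM2l//.
by rewrite ge_max !le_max lerD2r ab lexx orbT.
Qed.

(** The positive part is 1-Lipschitz in [lambda]. The bound is spelled as a linear combination,
    factor 1 included, to match [expectation_linear]. *)
Lemma xopt_increment v a b : 0 <= v -> a <= b ->
  xopt v b <= 1 * xopt v a + (b - a) / k * v.
Proof.
move=> v0 ab; rewrite /xopt mul1r [leRHS](_ : _ =
  v * (Num.max (a - v / 2) 0 + (b - a)) / k); last by ring.
rewrite ler_pM2r ?invr_gt0// ler_wpM2l// ge_max.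
have : a - v / 2 <= Num.max (a - v / 2) 0 by rewrite le_max lexx.
have : 0 <= Num.max (a - v / 2) 0 by rewrite le_max lexx orbT.
by move=> ? ?; apply/andP; split; lra.
Qed.

(** Dropping the positive part can only decrease the value. In expectation this is the affine
    minorant of [xi] that carries it past any given [alpha]. *)
Lemma xopt_ge v lambda : 0 <= v ->
  lambda / k * v + - (2 * k)^-1 * v ^+ 2 <= xopt v lambda.
Proof.
move=> v0; rewrite /xopt [leLHS](_ : _ = v * (lambda - v / 2) / k); last first.
  by field; rewrite !gt_eqF.
by rewrite ler_pM2r ?invr_gt0// ler_wpM2l// le_max lexx.
Qed.

(** As [lambda >= 0], the positive parts of [lambda - v / 2] and of [lambda ^+ 2 - (v / 2) ^+ 2]
    vanish together; elsewhere the cost contains the factors [lambda - v / 2] and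
    [lambda + v / 2]. *)
Lemma cost_xopt v lambda : 0 < v -> 0 <= lambda ->
  cost v (xopt v lambda) =
  1 / (4 * mu * rho) * (v * Num.max (lambda ^+ 2 - (v / 2) ^+ 2) 0).
Proof.
move=> v0 l0; rewrite /cost /xopt; have [lv|vl] := leP (lambda - v / 2) 0.
  rewrite max_r; last by rewrite subr_le0 ler_pXn2r ?nnegrE ?divr_ge0 ?(ltW v0)//; lra.
  by rewrite !(mulr0, mul0r, expr0n) addr0.
rewrite max_l; last by rewrite subr_ge0 ler_pXn2r ?nnegrE ?divr_ge0 ?(ltW v0)//; lra.
by field; rewrite !gt_eqF.
Qed.

Lemma cost_xopt_min v y lambda : 0 < v -> 0 <= y ->
  cost v (xopt v lambda) + lambda * (y - xopt v lambda) <= cost v y.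
Proof.
move=> v0 y0; have mr0 : 0 <= mu * rho / v by rewrite ltW// !mulr_gt0// invr_gt0.
have [lv|vl] := leP (lambda - v / 2) 0.
  have -> : xopt v lambda = 0 by rewrite /xopt max_r// mulr0 mul0r.
  rewrite /cost subr0 !(mulr0, mul0r, expr0n) !add0r.
  have : 0 <= (v / 2 - lambda) * y + mu * rho * (y ^+ 2 / v).
    rewrite addr_ge0 ?mulr_ge0 ?sqr_ge0 ?invr_ge0 ?(ltW mu_gt0) ?(ltW rho_gt0) ?(ltW v0)//.
    by lra.
  by lra.
(* When [lambda > v / 2], [xopt v lambda] is the unconstrained critical point, and completing the
   square leaves the quadratic term alone. *)
rewrite -subr_ge0 [leRHS](_ : _ = mu * rho / v * (y - xopt v lambda) ^+ 2).
  by rewrite mulr_ge0// sqr_ge0.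
rewrite /cost /xopt max_l ?ltW//.
by field; rewrite !gt_eqF.
Qed.

End pointwise.

(** * The stochastic problem: integrability, multipliers, duality *)

Section stochastic_problem.
Context d (T : measurableType d) (R : realType) (P : probability T R).
Context (V : {RV P >-> R}) (mu rho : R).
Hypotheses (V_gt0 : {ae P, forall w, 0 < V w})
  (V_sq : ('E_P[fun w => (V w ^+ 2)%R] < +oo)%E)
  (mu_gt0 : 0 < mu) (rho_gt0 : 0 < rho).

Local Notation k := (2 * mu * rho).
Local Notation xV lambda := (fun w => xopt mu rho (V w) lambda).
Local Notation xi := (xi P V mu rho).
Local Notation objective := (objective P V mu rho).
Local Notation feasible := (feasible P).
Local Notation is_minimizer := (is_minimizer P V mu rho).

Let k_gt0 : 0 < k. Proof. by rewrite !mulr_gt0. Qed.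

Let mV : measurable_fun setT V. Proof. exact: measurable_funPT. Qed.

Let V_ge0 : {ae P, forall w, 0 <= V w}.
Proof. by apply: filterS V_gt0 => w /ltW. Qed.

Let measurable_xV lambda : measurable_fun setT (xV lambda).
Proof.
apply: measurable_funM => //; apply: measurable_funM => //.
apply: measurable_maxr => //; apply: measurable_funB => //.
exact: measurable_funM.
Qed.

Let measurable_cost X : measurable_fun setT X ->
  measurable_fun setT (fun w => V w * X w / 2 + mu * rho * (X w ^+ 2 / V w)).
Proof.
move=> mX; apply: measurable_funD.
  by apply: measurable_funM => //; exact: measurable_funM.
apply: measurable_funM => //; apply: measurable_funM.
  exact: measurable_funX.
by apply: measurableT_comp => //; exact: measurable_invr.
Qed.

Let Lfun1_sqrV : (fun w => V w ^+ 2) \in Lfun P 1.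
Proof.
apply: ae_ge0_Lfun1 => //; first exact: measurable_funX.
by apply: aeW => w; exact: sqr_ge0.
Qed.

Let Lfun1_V : (V : T -> R) \in Lfun P 1.
Proof.
(* Domination by [1 + V ^+ 2], written in the shape of [Lfun1_linear]. *)
apply: (@Lfun1_ae_dominated _ _ _ _ _ (fun w => 1 * cst 1 w + 1 * V w ^+ 2)) => //.
  by apply: Lfun1_linear => //; exact: Lfun_cst.
apply: aeW => w /=; rewrite !mul1r ler_norml.
by apply/andP; split; nra.
Qed.

Let Lfun1_xV lambda : xV lambda \in Lfun P 1.
Proof.
apply: (@Lfun1_ae_dominated _ _ _ _ _ ((`|lambda| / k) \o* V)) => //.
  exact: Lfun_scale.
apply: filterS V_ge0 => w Vw /=.
by rewrite ger0_norm ?xopt_ge0// mulrC xopt_le.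
Qed.

Let meanV := fine 'E_P[V]%E.

Let meanVE : 'E_P[V]%E = meanV%:E.
Proof. by rewrite fineK// expectation_fin_num. Qed.

Let meanV_gt0 : 0 < meanV.
Proof.
have : (0 <= 'E_P[V])%E by exact: expectation_ae_ge0.
rewrite meanVE lee_fin le_eqVlt => /predU1P[m0|//].
have V0 : {ae P, forall w, V w = 0}.
  by apply: ae_ge0_expectation_eq0 => //; rewrite meanVE -m0.
(* Since the total mass is positive, the almost sure events [V = 0] and [V > 0] would have a common
   point. *)
have P1 : (0 < P setT)%E by rewrite probability_setT.
have [w [Vw]] := @filter_ex _ _ (ae_properfilter_algebraOfSetsType P1) _
  (filterI V0 V_gt0).
by rewrite Vw ltxx.
Qed.

Lemma xi_fin_num lambda : xi lambda \is a fin_num.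
Proof. exact: expectation_fin_num. Qed.

Lemma xi_increment a b : a <= b ->
  fine (xi a) <= fine (xi b) <= fine (xi a) + (b - a) / k * meanV.
Proof.
move=> ab; apply/andP; split; rewrite -lee_fin.
  rewrite !fineK ?xi_fin_num//; apply: ae_expectation_le => //.
  by apply: filterS V_ge0 => w Vw; exact: xopt_nondecreasing.
rewrite EFinD EFinM -meanVE -[fine (xi a)]mul1r EFinM !fineK ?xi_fin_num//.
rewrite -expectation_linear//; apply: ae_expectation_le => //.
  by apply: measurable_funD => //; exact: measurable_funM.
by apply: filterS V_ge0 => w Vw; exact: xopt_increment.
Qed.

Lemma xi_continuous :
  {within `[0, +oo[, continuous (fun lambda => fine (xi lambda))}.
Proof.
apply: (@locally_lipschitz_within_itvcy _ _ (fun=> meanV / k)) => M a b _ ab _ _.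
have /andP[? ?] := xi_increment ab; rewrite ger0_norm ?subr_ge0//.
by rewrite lerBlDl (mulrC (_ / _)) mulrCA mulrC.
Qed.

Let xi0 : xi 0 = 0%E.
Proof.
rewrite -[RHS](expectation_cst P); apply: ae_expectation_eq => //.
apply: filterS V_ge0 => w Vw; rewrite /xopt max_r ?mulr0 ?mul0r//.
by rewrite subr_le0 divr_ge0.
Qed.

Lemma exists_multiplier alpha : 0 < alpha ->
  exists2 lambda, 0 < lambda & xi lambda = alpha%:E.
Proof.
move=> a0; pose s := fine 'E_P[fun w => (V w ^+ 2)%R]%E.
have sE : 'E_P[fun w => (V w ^+ 2)%R]%E = s%:E.
  by rewrite /s fineK// expectation_fin_num.
have s0 : 0 <= s by rewrite fine_ge0// expectation_ge0// => w; exact: sqr_ge0.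
have xi_ge lambda : lambda / k * meanV + - (2 * k)^-1 * s <= fine (xi lambda).
  rewrite -lee_fin fineK ?xi_fin_num// EFinD !EFinM -sE -meanVE -!EFinM.
  rewrite -expectation_linear//; apply: ae_expectation_le => //.
    apply: measurable_funD; apply: measurable_funM => //.
    exact: measurable_funX.
  by apply: filterS V_ge0 => w Vw; exact: xopt_ge.
(* [b] is the point where the affine minorant [xi_ge] takes the value [alpha]. *)
pose b := (alpha + (2 * k)^-1 * s) / meanV * k.
have b0 : 0 <= b.
  rewrite mulr_ge0 ?(ltW k_gt0)// divr_ge0 ?(ltW meanV_gt0)// addr_ge0 ?(ltW a0)//.
  by rewrite mulr_ge0// invr_ge0 mulr_ge0// ltW.
have alpha_le : alpha <= fine (xi b).
  apply: le_trans (xi_ge b); rewrite le_eqVlt; apply/orP; left; apply/eqP.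
  by rewrite /b; field; rewrite !gt_eqF.
have [||lambda + xil] := @IVT _ (fun lambda => fine (xi lambda)) 0 b alpha b0.
- apply: continuous_subspaceW xi_continuous.
  by move=> x; rewrite /= !in_itv /= andbT => /andP[].
- by rewrite xi0 /= ge_min le_max (ltW a0) alpha_le orbT.
rewrite in_itv /= => /andP[l0 _]; exists lambda; last first.
  by rewrite -xil fineK ?xi_fin_num.
(* The intermediate value theorem gives only [0 <= lambda]; zero is excluded by
   [xi 0 = 0 < alpha]. *)
rewrite lt_neqAle l0 andbT; apply: contraTneq a0 => l0'.
by rewrite -xil -l0' xi0 /= ltxx.
Qed.

Lemma feasible_xopt lambda alpha :
  xi lambda = alpha%:E -> feasible alpha (xV lambda).
Proof.
by move=> xil; split => //; apply: filterS V_ge0 => w; exact: xopt_ge0.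
Qed.

Let Lfun1_value lambda :
  (fun w => V w * Num.max (lambda ^+ 2 - (V w / 2) ^+ 2) 0) \in Lfun P 1.
Proof.
apply: (@Lfun1_ae_dominated _ _ _ _ _ (lambda ^+ 2 \o* V)) => //.
- apply: measurable_funM => //; apply: measurable_maxr => //.
  apply: measurable_funB => //; apply: measurable_funX.
  exact: measurable_funM.
- exact: Lfun_scale.
apply: filterS V_ge0 => w Vw /=.
rewrite ger0_norm; last by rewrite mulr_ge0// le_max lexx orbT.
by rewrite ler_wpM2l// ge_max sqr_ge0 lerBlDr lerDl sqr_ge0.
Qed.

Lemma objective_xopt lambda : 0 <= lambda ->
  objective (xV lambda) = ((1 / (4 * mu * rho))%:E *
    'E_P[fun w => (V w * Num.max (lambda ^+ 2 - (V w / 2) ^+ 2) 0)%R])%E.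
Proof.
move=> l0; rewrite -expectationZl//; apply: ae_expectation_eq => //.
- exact: measurable_cost.
- apply/measurable_EFinP.
  have := Lfun_scale (1 / (4 * mu * rho)) (lexx 1) (Lfun1_value lambda).
  by move=> /Lfun1_integrable/integrableP[].
by apply: filterS V_gt0 => w Vw; rewrite cost_xopt// mulrC.
Qed.

Let objective_xopt_fin_num lambda : 0 <= lambda ->
  objective (xV lambda) \is a fin_num.
Proof.
by move=> l0; rewrite objective_xopt// fin_numM// expectation_fin_num.
Qed.

Let Lfun1_cost_xopt lambda : 0 <= lambda ->
  (fun w => V w * xV lambda w / 2 + mu * rho * (xV lambda w ^+ 2 / V w))
    \in Lfun P 1.
Proof.
move=> l0; apply: ae_ge0_Lfun1; first exact: measurable_cost.
  apply: filterS V_gt0 => w Vw; rewrite cost_xopt//.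
  rewrite mulr_ge0//; first by rewrite divr_ge0// !mulr_ge0// ltW.
  by rewrite mulr_ge0 ?(ltW Vw)// le_max lexx orbT.
by rewrite ltey_eq objective_xopt_fin_num.
Qed.

(** Integrates [cost_xopt_min]. The left side becomes the expectation of one integrable variable
    once [beta - alpha] is written as the mean of [Y - xV lambda]; the cost of [Y] may have
    expectation [+oo]. *)
Lemma objective_support lambda alpha beta Y : 0 <= lambda ->
  xi lambda = alpha%:E -> feasible beta Y ->
  (objective (xV lambda) + (lambda * (beta - alpha))%:E <= objective Y)%E.
Proof.
move=> l0 xil [mY Y0 EY].
have LY : Y \in Lfun P 1 by apply: ae_ge0_Lfun1 => //; rewrite EY ltry.
have -> : (lambda * (beta - alpha))%:E =
    (lambda%:E * 'E_P[fun w => (1 * Y w + -1 * xV lambda w)%R])%E.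
  rewrite expectation_linear// EY (xil : 'E_P[xV lambda]%E = _).
  by rewrite -!EFinM; congr (_%:E); ring.
rewrite -[X in (X + _)%E]mul1e -expectation_linear; last 2 first.
- exact: Lfun1_cost_xopt.
- exact: Lfun1_linear.
apply: ae_expectation_le; last 2 first.
- exact: measurable_cost.
- apply: filterS2 V_gt0 Y0 => w Vw Yw; rewrite !mul1r mulN1r.
  exact: cost_xopt_min.
apply: measurable_funD; apply: measurable_funM => //.
  exact: measurable_cost.
by apply: measurable_funD; apply: measurable_funM.
Qed.

Lemma xopt_is_minimizer lambda alpha : 0 <= lambda -> xi lambda = alpha%:E ->
  is_minimizer alpha (xV lambda).
Proof.
move=> l0 xil; split; first exact: feasible_xopt.
move=> Y /(objective_support l0 xil).
by rewrite subrr mulr0 adde0.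
Qed.

Lemma objective_cst0 : objective (cst 0) = 0%E.
Proof.
rewrite -[RHS](expectation_cst P); congr ('E_P[_])%E; apply/funext => w /=.
by rewrite expr0n !(mulr0, mul0r) addr0.
Qed.

(** All feasible costs are almost surely nonnegative and the zero variable costs nothing. This
    justifies the separate value 0 in [value_fun] at [alpha = 0], where no multiplier is
    supplied. *)
Lemma cst0_is_minimizer : is_minimizer 0 (cst 0).
Proof.
split; first by split => //; [exact: aeW|exact: expectation_cst].
move=> Y [mY Y0 _]; rewrite objective_cst0.
apply: expectation_ae_ge0; first exact: measurable_cost.
apply: filterS2 V_gt0 Y0 => w Vw Yw.
by rewrite addr_ge0 ?divr_ge0 ?mulr_ge0 ?sqr_ge0 ?invr_ge0
  ?(ltW Vw) ?(ltW mu_gt0) ?(ltW rho_gt0).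
Qed.

Lemma optimal_value_minimizer alpha X : is_minimizer alpha X ->
  optimal_value P V mu rho alpha = objective X.
Proof.
move=> [fX minX]; apply/eqP; rewrite eq_le; apply/andP; split.
  by apply: ereal_inf_lbound; exists X.
by apply: le_ereal_inf_tmp => _ [Y fY <-]; exact: minX.
Qed.

(** * The value function for an arbitrary selection of multipliers *)

Section value_function.
Variable lam : R -> R.
Hypothesis lam_multiplier :
  forall alpha, 0 < alpha -> 0 < lam alpha /\ xi (lam alpha) = alpha%:E.

Local Notation f := (value_fun P V mu rho lam).

Let value_fun_xopt alpha : 0 < alpha -> f alpha = objective (xV (lam alpha)).
Proof.
move=> a0; have [l0 _] := lam_multiplier a0.
by rewrite /value_fun gt_eqF// objective_xopt// ltW.
Qed.

Let value_fun0 : f 0 = 0%E. Proof. by rewrite /value_fun eqxx. Qed.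

Lemma value_fun_minimizer alpha : 0 <= alpha ->
  exists2 X, is_minimizer alpha X & objective X = f alpha.
Proof.
rewrite le_eqVlt => /predU1P[<-|a0].
  by exists (cst 0); [exact: cst0_is_minimizer|rewrite value_fun0 objective_cst0].
have [l0 xil] := lam_multiplier a0.
by exists (xV (lam alpha)); [apply: xopt_is_minimizer => //; exact: ltW|
  rewrite value_fun_xopt].
Qed.

Lemma value_fun_fin_num alpha : 0 <= alpha -> f alpha \is a fin_num.
Proof.
rewrite le_eqVlt => /predU1P[<-|a0]; first by rewrite value_fun0.
have [l0 _] := lam_multiplier a0.
by rewrite value_fun_xopt// objective_xopt_fin_num// ltW.
Qed.

Lemma optimal_value_value_fun alpha : 0 <= alpha ->
  optimal_value P V mu rho alpha = f alpha.
Proof.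
by move=> /value_fun_minimizer[X minX <-]; exact: optimal_value_minimizer.
Qed.

(** [objective_support] with the multiplier of [a], tested on a minimizer that attains [f b]; this
    includes the endpoint [b = 0]. *)
Lemma value_fun_support a b : 0 < a -> 0 <= b ->
  fine (f a) + lam a * (b - a) <= fine (f b).
Proof.
move=> a0 b0; have [l0 xil] := lam_multiplier a0.
rewrite -lee_fin EFinD !fineK ?value_fun_fin_num ?(ltW a0)// value_fun_xopt//.
have [X [fX _] <-] := value_fun_minimizer b0.
by apply: objective_support => //; exact: ltW.
Qed.

Lemma value_fun_ge0 b : 0 <= b -> 0 <= fine (f b).
Proof.
rewrite le_eqVlt => /predU1P[<-|b0]; first by rewrite value_fun0.
rewrite fine_ge0// /value_fun gt_eqF// mule_ge0//.
  by rewrite lee_fin divr_ge0// !mulr_ge0 ?ltW.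
have [? _] := lam_multiplier b0.
apply: expectation_ae_ge0.
  apply/measurable_EFinP.
  by have /Lfun1_integrable/integrableP[] := Lfun1_value (lam b).
by apply: filterS V_ge0 => w Vw; rewrite mulr_ge0// le_max lexx orbT.
Qed.

End value_function.

End stochastic_problem.

Theorem theorem2 (d : measure_display) (T : measurableType d) (R : realType)
    (P : probability T R) (V : {RV P >-> R}) (mu rho : R)
    (V_gt0 : {ae P, forall w, 0 < V w})
    (V_sq : ('E_P[fun w => (V w ^+ 2)%R] < +oo)%E)
    (mu_gt0 : 0 < mu) (rho_gt0 : 0 < rho) :
  [/\ (forall lambda : R, xi P V mu rho lambda \is a fin_num) /\
      {within `[0, +oo[, continuous (fun lambda => fine (xi P V mu rho lambda))},
      forall alpha : R, 0 < alpha ->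
        exists lambda : R,
          [/\ 0 < lambda, xi P V mu rho lambda = alpha%:E &
              is_minimizer P V mu rho alpha
                (fun w => xopt mu rho (V w) lambda)]
    & forall lam : R -> R,
        (forall alpha : R, 0 < alpha ->
           0 < lam alpha /\ xi P V mu rho (lam alpha) = alpha%:E) ->
        let f := value_fun P V mu rho lam in
        [/\ forall alpha : R, 0 <= alpha ->
              optimal_value P V mu rho alpha = f alpha,
            forall alpha : R, 0 <= alpha -> f alpha \is a fin_num,
            convex_function (`[0, +oo[%classic : set R) (fun x => fine (f x)),
            {in `[0, +oo[ &, forall x y : R, x <= y -> (f x <= f y)%E}
          & {within `[0, +oo[, continuous (fun x => fine (f x))}]].
Proof.
split.
- split; first exact: xi_fin_num.
  exact: xi_continuous.
- move=> alpha a0; have [lambda l0 xil] := exists_multiplier V_gt0 V_sq mu_gt0 rho_gt0 a0.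
  by exists lambda; split => //; apply: xopt_is_minimizer => //; exact: ltW.
(* The real function [fine (f x)] with slopes [lam] meets the hypotheses of the supporting line
   lemmas; finiteness of [f] carries monotonicity back to [\bar R]. *)
move=> lam lamP f.
have f0 : fine (f 0) = 0 by rewrite /f /value_fun eqxx.
have lam_gt0 a : 0 < a -> 0 < lam a by move=> /lamP[].
have f_ge0 b : 0 <= b -> 0 <= fine (f b) by exact: value_fun_ge0.
have f_support a b : 0 < a -> 0 <= b -> fine (f a) + lam a * (b - a) <= fine (f b).
  exact: value_fun_support.
have f_fin a : 0 <= a -> f a \is a fin_num by exact: value_fun_fin_num.
split=> //.
- by move=> alpha a0; exact: optimal_value_value_fun.
- exact: supporting_lines_convex f_support f0 f_ge0.
- move=> x y; rewrite !in_itv /= !andbT => x0 y0 xy.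
  rewrite -[f x]fineK ?f_fin// -[f y]fineK ?f_fin// lee_fin.
  exact: (supporting_lines_nondecreasing lam_gt0 f_support f0 f_ge0).
- exact: supporting_lines_continuous lam_gt0 f_support f0 f_ge0.
Qed.
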